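(* Consider a discrete convex single-parameter auction setting with feasibility set $\mathcal A$ and objective $\mathsf{Obj}_\alpha(M)=\alpha\,\mathsf{Rev}(M)+(1-\alpha)\,\mathsf{SW}(M)$ for a fixed $\alpha\in[0,1]$. Then: (1) If the setting is TDI, there exists an auction maximizing $\mathsf{Obj}_\alpha$ over all feasible BIC auctions which is integral. (2) Every feasible DSIC auction that maximizes $\mathsf{Obj}_\alpha$ over all feasible DSIC auctions also maximizes $\mathsf{Obj}_\alpha$ over all feasible BIC auctions. (3) Let $M^\alpha=(\mathbf a,\mathbf p)$ be defined by: for each $\mathbf v\in\mathbf V$, $\mathbf a(\mathbf v)\in\arg\max_{x\in\mathcal A}\sum_{i=1}^n\bar\varphi^\alpha_i(v_i)x_i$, where the selected maximizer depends only on the vector $(\bar\varphi^\alpha_1(v_1),\dots,\bar\varphi^\alpha_n(v_n))$ (a fixed deterministic tie-breaking rule), and $\mathbf p$ is given by the payment formula $p_i(v_{i,k},\mathbf v_{-i})=v_{i,k}\,a_i(v_{i,k},\mathbf v_{-i})-\sum_{l=1}^{k-1}(v_{i,l+1}-v_{i,l})\,a_i(v_{i,l},\mathbf v_{-i})$. Then $M^\alpha$ is DSIC and maximizes $\mathsf{Obj}_\alpha$ over all feasible BIC auctions.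
   Context: There are $n\ge1$ bidders; bidder $i$ has finite value set $V_i=\{v_{i,1}<\dots<v_{i,K_i}\}\subset\mathbb R_+$ and independent value with pmf $f_i$, $f_i(v)>0$ on $V_i$, cdf $F_i$; $\mathbf V=\prod_iV_i$, $\mathbf F$ the product distribution, $\mathbf F_{-i}$ the product over $j\ne i$. Feasibility: $\mathcal A=\{x\in\mathbb R^n: g_j(x)\le0,\ j\in[m]\}\subseteq\mathbb R^n_+$, with each $g_j$ convex and continuously differentiable, and $\mathcal A$ nonempty and compact; an auction $(\mathbf a,\mathbf p)$, $\mathbf a:\mathbf V\to\mathbb R^n_+$, $\mathbf p:\mathbf V\to\mathbb R^n$, is feasible if $\mathbf a(\mathbf v)\in\mathcal A$ for all $\mathbf v$. Utility $u_i(\mathbf b;v_i)=a_i(\mathbf b)v_i-p_i(\mathbf b)$; bids extended to $\bar V_i=V_i\cup\{\varnothing\}$ with $a_i(\varnothing,\cdot)=p_i(\varnothing,\cdot)=0$. DSIC: $u_i(v_i,\mathbf b_{-i};v_i)\ge u_i(b_i,\mathbf b_{-i};v_i)$ for all $i$, $v_i\in V_i$, $b_i\in\bar V_i$, $\mathbf b_{-i}$. BIC: with $A_i(b_i)=\mathbb E_{\mathbf v_{-i}\sim\mathbf F_{-i}}[a_i(b_i,\mathbf v_{-i})]$, $P_i(b_i)=\mathbb E_{\mathbf v_{-i}\sim\mathbf F_{-i}}[p_i(b_i,\mathbf v_{-i})]$, require $A_i(v_i)v_i-P_i(v_i)\ge A_i(b_i)v_i-P_i(b_i)$ for all $i,v_i\in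 V_i,b_i\in\bar V_i$. $\mathsf{Rev}(M)=\mathbb E_{\mathbf v\sim\mathbf F}[\sum_ip_i(\mathbf v)]$, $\mathsf{SW}(M)=\mathbb E_{\mathbf v\sim\mathbf F}[\sum_ia_i(\mathbf v)v_i]$. An auction is integral if $\mathbf a(\mathbf v)\in\mathbb N^n$ for all $\mathbf v$. TDI setting: $\mathcal A=\{x\in\mathbb R^n:Gx\le b\}$ for a rational matrix $G$ and integral vector $b$ such that the system $Gx\le b$ is totally dual integral: for every integral $c\in\mathbb Z^n$ for which $\min\{\psi^\top b:\psi\ge0,\ G^\top\psi=c\}$ is finite, this minimum is attained by an integral $\psi$. Generalized virtual values: $\varphi^\alpha_i(v_{i,k})=v_{i,k}-\alpha(v_{i,k+1}-v_{i,k})\frac{1-F_i(v_{i,k})}{f_i(v_{i,k})}$, $k\in[K_i]$ (second term $0$ for $k=K_i$). Ironed generalized virtual values: let $F^{(i)}_0=0$, $F^{(i)}_k=F_i(v_{i,k})$, $S^{(i)}_0=0$, $S^{(i)}_k=\sum_{j\le k}\varphi^\alpha_i(v_{i,j})f_i(v_{i,j})$, $S^{(i)}$ the piecewise linear interpolation of the points $(F^{(i)}_k,S^{(i)}_k)$, and $H^{(i)}$ its lower convex envelope; $\bar\varphi^\alpha_i(v_{i,k})$ is the slope of $H^{(i)}$ on $(F^{(i)}_{k-1},F^{(i)}_k)$. *)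

(* Defs.v *)
From HB Require Import structures.
From mathcomp Require Import all_boot all_order all_algebra.
From mathcomp Require Import all_classical all_reals all_analysis.
Unset Printing Implicit Defensive.
Import Order.TTheory GRing.Theory Num.Theory.
Import numFieldNormedType.Exports.
Local Open Scope ring_scope.

Section Auction.
Variables (R : realType) (n : nat) (K : 'I_n -> nat).

(* value profiles: bidder i reports the index (0-based) of a value in V_i *)
Definition prof := {dffun forall i : 'I_n, 'I_(K i)}.

Definition upd (w : prof) (i : 'I_n) (k : 'I_(K i)) : prof :=
  @finfun _ (fun j => 'I_(K j))
    (fun j => match i =P j with
              | ReflectT e => ecast j 'I_(K j) e k
              | ReflectF _ => w j
              end).

Record auction := Auction { alloc : prof -> 'I_n -> R ; pay : prof -> 'I_n -> R }.

(* val i j = v_{i,j+1}, f i j = f_i(v_{i,j+1}) for j < K i *)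
Variables (val f : forall i : 'I_n, nat -> R).

Definition weight (w : prof) : R := \prod_i f i (w i).
Definition Ex (X : prof -> R) : R := \sum_(w : prof) weight w * X w.
Definition Rev (M : auction) : R := Ex (fun w => \sum_i pay M w i).
Definition SW (M : auction) : R := Ex (fun w => \sum_i alloc M w i * val i (w i)).
Definition Obj (alpha : R) (M : auction) : R :=
  alpha * Rev M + (1 - alpha) * SW M.

(* utility of bidder i with true value x, bidding b (None = the empty bid),
   others bidding w_{-i} *)
Definition util (M : auction) (i : 'I_n) (b : option 'I_(K i)) (w : prof) (x : R) : R :=
  if b is Some k then alloc M (upd w i k) i * x - pay M (upd w i k) i else 0.

Definition DSIC (M : auction) : Prop :=
  forall (i : 'I_n) (w : prof) (b : option 'I_(K i)),
    util M i b w (val i (w i)) <= util M i (Some (w i)) w (val i (w i)).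

(* interim allocation / payment: expectation over v_{-i} ~ F_{-i} *)
Definition interimA (M : auction) (i : 'I_n) (b : option 'I_(K i)) : R :=
  if b is Some k then
    \sum_(w : prof | w i == k) (\prod_(j | j != i) f j (w j)) * alloc M w i
  else 0.
Definition interimP (M : auction) (i : 'I_n) (b : option 'I_(K i)) : R :=
  if b is Some k then
    \sum_(w : prof | w i == k) (\prod_(j | j != i) f j (w j)) * pay M w i
  else 0.

Definition BIC (M : auction) : Prop :=
  forall (i : 'I_n) (k : 'I_(K i)) (b : option 'I_(K i)),
    interimA M i b * val i k - interimP M i b
      <= interimA M i (Some k) * val i k - interimP M i (Some k).

Variables (m : nat) (g : 'I_m -> 'rV[R]_n -> R).

Definition feasA (x : 'rV[R]_n) : Prop := forall j, g j x <= 0.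

Definition feasible (M : auction) : Prop :=
  forall w, (forall i, 0 <= alloc M w i) /\ feasA (\row_i alloc M w i).

Definition integral_auction (M : auction) : Prop :=
  forall w i, alloc M w i \is a Num.nat.

Definition BIC_opt (alpha : R) (M : auction) : Prop :=
  [/\ feasible M, BIC M &
      forall M', feasible M' -> BIC M' -> Obj alpha M' <= Obj alpha M].
Definition DSIC_opt (alpha : R) (M : auction) : Prop :=
  [/\ feasible M, DSIC M &
      forall M', feasible M' -> DSIC M' -> Obj alpha M' <= Obj alpha M].

Definition TDI (p : nat) (G : 'M[rat]_(p, n)) (b : 'cV[int]_p) : Prop :=
  forall c : 'I_n -> int,
    let dfeas (psi : 'I_p -> R) :=
      (forall k, 0 <= psi k) /\ (forall i, \sum_k ratr (G k i) * psi k = (c i)%:~R) in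
    let dobj (psi : 'I_p -> R) := \sum_k psi k * (b k ord0)%:~R in
    (exists psi, dfeas psi /\ forall psi', dfeas psi' -> dobj psi <= dobj psi') ->
    exists psi, (forall k, psi k \is a Num.int) /\ dfeas psi /\
                forall psi', dfeas psi' -> dobj psi <= dobj psi'.

Definition TDI_setting : Prop :=
  exists (p : nat) (G : 'M[rat]_(p, n)) (b : 'cV[int]_p),
    (forall x, feasA x <-> forall k, \sum_i ratr (G k i) * x ord0 i <= (b k ord0)%:~R)
    /\ TDI p G b.

(* generalized virtual values (0-based index j stands for v_{i,j+1}) *)
Definition cdf (i : 'I_n) (j : nat) : R := \sum_(l < j.+1) f i l.
Definition phi (alpha : R) (i : 'I_n) (j : nat) : R :=
  if (j.+1 < K i)%N
  then val i j - alpha * (val i j.+1 - val i j) * (1 - cdf i j) / f i j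
  else val i j.

Definition Fpt (i : 'I_n) (k : nat) : R := \sum_(l < k) f i l.
Definition Spt (alpha : R) (i : 'I_n) (k : nat) : R :=
  \sum_(l < k) phi alpha i l * f i l.

(* piecewise linear interpolation of the points (F_k, S_k) on [0,1] *)
Definition Sint (alpha : R) (i : 'I_n) (x : R) : R :=
  \sum_(k < K i)
    (Spt alpha i k.+1 - Spt alpha i k) / (Fpt i k.+1 - Fpt i k) *
    (Num.min (Num.max x (Fpt i k)) (Fpt i k.+1) - Fpt i k).

Definition convex01 (h : R -> R) : Prop :=
  forall x y t, 0 <= x <= 1 -> 0 <= y <= 1 -> 0 <= t <= 1 ->
    h (t * x + (1 - t) * y) <= t * h x + (1 - t) * h y.

Definition Henv (alpha : R) (i : 'I_n) (x : R) : R :=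
  sup [set y | exists h, [/\ convex01 h,
                            (forall z, 0 <= z <= 1 -> h z <= Sint alpha i z) &
                            y = h x]].

Definition phibar (alpha : R) (i : 'I_n) (j : nat) : R :=
  (Henv alpha i (Fpt i j.+1) - Henv alpha i (Fpt i j)) / (Fpt i j.+1 - Fpt i j).

Definition is_argmax (c : 'I_n -> R) (x : 'I_n -> R) : Prop :=
  feasA (\row_i x i) /\
  forall y, feasA y -> \sum_i c i * y ord0 i <= \sum_i c i * x i.

Definition phibar_prof (alpha : R) (w : prof) : 'I_n -> R :=
  fun j => phibar alpha j (w j).

Definition Malpha (alpha : R) (sel : ('I_n -> R) -> 'I_n -> R) : auction :=
  let a := fun w => sel (phibar_prof alpha w) in
  Auction a
    (fun w i => val i (w i) * a w i -
       \sum_(l : 'I_(K i) | (l < w i)%N) (val i l.+1 - val i l) * a (upd w i l) i).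

End Auction.

(* Main.v *)
Require Import Defs.
From HB Require Import structures.
From mathcomp Require Import all_boot all_order all_algebra.
From mathcomp Require Import all_classical all_reals all_analysis.
From mathcomp Require Import ring lra.
Import Order.TTheory GRing.Theory Num.Theory.
Import numFieldNormedType.Exports.
Local Open Scope classical_set_scope.
Local Open Scope ring_scope.

(** For BIC auctions, incentive compatibility between adjacent values bounds the
    payments by the payment formula, so the objective is at most the expected
    generalized virtual welfare.  Interim allocations are nondecreasing, hence
    Abel summation against [S - H >= 0] bounds it further by the ironed virtual
    welfare, which [M^alpha] maximizes pointwise; for [M^alpha] both bounds are
    equalities, because the ironed values are constant wherever [H < S].

    For integrality, LP duality and total dual integrality make the support
    function [h] of the feasible set integral on integral vectors.  The support
    function of the face exposed by an integral [c] is the limit of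
    [h (N c + d) - N h c], a limit of integers, so it is integral as well.
    Exposing successively in the directions of all coordinates yields an integral
    maximizer for every integral [c], and approximation handles real [c]. *)

Set Implicit Arguments.
Unset Strict Implicit.

(** * Linear programming duality *)

Definition dot (R : pzRingType) (n : nat) (c y : 'I_n -> R) : R :=
  \sum_i c i * y i.

Section Dot.
Variables (R : realFieldType) (n : nat).
Implicit Types c y : 'I_n -> R.

Lemma dotDl c d y : dot (c \+ d) y = dot c y + dot d y.
Proof. by rewrite -big_split; apply: eq_bigr => i _; rewrite /= mulrDl. Qed.

Lemma dotDr c y z : dot c (y \+ z) = dot c y + dot c z.
Proof. by rewrite -big_split; apply: eq_bigr => i _; rewrite /= mulrDr. Qed.

Lemma dotZl t c y : dot (fun i => t * c i) y = t * dot c y.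
Proof. by rewrite /dot mulr_sumr; apply: eq_bigr => i _; rewrite mulrA. Qed.

Lemma dotZr t c y : dot c (fun i => t * y i) = t * dot c y.
Proof. by rewrite /dot mulr_sumr; apply: eq_bigr => i _; rewrite mulrCA. Qed.

Lemma dot_sum (p : nat) (psi : 'I_p -> R) (a : 'I_p -> 'I_n -> R) y :
  dot (fun i => \sum_k psi k * a k i) y = \sum_k psi k * dot (a k) y.
Proof.
rewrite /dot; under eq_bigr do rewrite mulr_suml.
rewrite exchange_big; apply: eq_bigr => k _; rewrite mulr_sumr.
by apply: eq_bigr => i _; rewrite mulrA.
Qed.

(* Bartl's induction: if dropping the first row breaks the implication, a
   witness [x] normalised by [dot (a ord0) x = 1] allows to project along [x]
   onto the kernel of the first row. *)
Lemma farkas (p : nat) (a : 'I_p -> 'I_n -> R) c :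
  (forall y, (forall k, dot (a k) y <= 0) -> dot c y <= 0) ->
  exists2 psi : 'I_p -> R, (forall k, 0 <= psi k) &
    forall i, c i = \sum_k psi k * a k i.
Proof.
elim: p a c => [|p IHp] a c hac.
  exists (fun=> 0) => // i; rewrite big_ord0.
  (* Without rows, [c] itself is an admissible test vector, which forces [c = 0]. *)
  have /hac : forall k, dot (a k) c <= 0 by case.
  rewrite /dot => c2.
  have : \sum_i c i * c i == 0.
    by rewrite eq_le c2 sumr_ge0// => j _; rewrite -expr2 sqr_ge0.
  rewrite psumr_eq0; last by move=> j _; rewrite -expr2 sqr_ge0.
  by move=> /allP/(_ i (mem_index_enum _)); rewrite /= mulf_eq0 orbb => /eqP.
pose a0 := a ord0; pose a' k := a (lift ord0 k).
have [h|/existsNP [x0 /not_implyP[ax0 /negP]]] :=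
  pselect (forall y, (forall k, dot (a' k) y <= 0) -> dot c y <= 0).
  have [psi psi0 psiE] := IHp a' c h.
  exists (fun k => if unlift ord0 k is Some l then psi l else 0).
    by move=> k; case: unlift.
  move=> i; rewrite big_ord_recl unlift_none mul0r add0r psiE.
  by apply: eq_bigr => k _; rewrite liftK.
rewrite -ltNge => cx0.
have a0x0 : 0 < dot a0 x0.
  rewrite ltNge; apply/negP => a0x0; suff: dot c x0 <= 0 by rewrite leNgt cx0.
  apply: hac => k; case: (unliftP ord0 k) => [l ->|->] //; exact: ax0.
pose x i := (dot a0 x0)^-1 * x0 i.
have a0x : dot a0 x = 1 by rewrite dotZr mulVf// gt_eqF.
have a'x k : dot (a' k) x <= 0.
  by rewrite dotZr; apply: mulr_ge0_le0 => //; rewrite invr_ge0 ltW.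
have cx : 0 <= dot c x by rewrite dotZr mulr_ge0// ?invr_ge0 ltW.
(* Projecting the rows is adjoint to projecting the vector, so the induction hypothesis can be fed
   from [hac]. *)
have projE d y : dot (d \+ (fun i => - dot d x * a0 i)) y =
    dot d (y \+ (fun i => - dot a0 y * x i)).
  by rewrite dotDl dotDr (dotZl (- dot d x)) (dotZr (- dot a0 y)); ring.
have [|psi psi0 psiE] := IHp (fun k => a' k \+ (fun i => - dot (a' k) x * a0 i))
    (c \+ (fun i => - dot c x * a0 i)).
  move=> y ha; rewrite projE; apply: hac => k.
  case: (unliftP ord0 k) => [l ->|->]; first by rewrite -projE; exact: ha.
  by rewrite dotDr (dotZr (- dot a0 y)) -/a0 a0x; lra.
exists (fun k => if unlift ord0 k is Some l then psi l
             else dot c x - \sum_l psi l * dot (a' l) x).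
  move=> k; case: unlift => // ; rewrite subr_ge0 (le_trans _ cx)//.
  by apply: sumr_le0 => l _; apply: mulr_ge0_le0.
move=> i; rewrite big_ord_recl unlift_none -/a0.
have := psiE i; rewrite /= => /eqP; rewrite mulNr subr_eq => /eqP ->.
under eq_bigr do rewrite mulrDr mulNr mulrN mulrA.
rewrite sumrB -mulr_suml.
under [X in _ = _ + X]eq_bigr do rewrite liftK.
by rewrite -/a'; ring.
Qed.

(** Farkas' lemma for the constraints active at [x]: a direction violating its premise could be
    followed a little way inside the polyhedron, improving on [x]. *)
Lemma lp_duality (p : nat) (G : 'I_p -> 'I_n -> R) (b : 'I_p -> R) c x :
  (forall k, dot (G k) x <= b k) ->
  (forall y, (forall k, dot (G k) y <= b k) -> dot c y <= dot c x) ->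
  exists psi : 'I_p -> R, [/\ (forall k, 0 <= psi k),
    (forall i, c i = \sum_k psi k * G k i) &
    \sum_k psi k * b k = dot c x].
Proof.
move=> xP xmax.
pose act k := dot (G k) x == b k.
have [y yP|psi psi0 psiE] := @farkas p (fun k i => (act k)%:R * G k i) c.
  pose s k := b k - dot (G k) x.
  (* A step length that no inactive row exhausts; active rows have slack 0 and add 0 to the sum,
     since division by 0 gives 0. *)
  pose e := (1 + \sum_k `|dot (G k) y| / s k)^-1.
  have s0 k : 0 <= s k by rewrite subr_ge0.
  have S0 k : 0 <= `|dot (G k) y| / s k by rewrite divr_ge0.
  have e0 : 0 < e by rewrite invr_gt0 ltr_pwDl// sumr_ge0.
  have := xmax (x \+ (fun i => e * y i)).
  rewrite dotDr dotZr gerDl pmulr_rle0//; apply => k.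
  rewrite dotDr dotZr -lerBrDl -/(s k).
  have [kA|kA] := boolP (act k).
    have := yP k; rewrite dotZl kA mul1r => Gy; apply: le_trans (s0 k).
    by rewrite pmulr_rle0.
  have sk : 0 < s k by rewrite lt_neqAle s0 andbT eq_sym subr_eq0 eq_sym.
  rewrite /e mulrC ler_pdivrMr; last by rewrite ltr_pwDl// sumr_ge0.
  rewrite -ler_pdivrMl// mulrC (bigD1 k)//= addrCA.
  apply: (@le_trans _ _ (`|dot (G k) y| / s k)).
    by rewrite ler_wpM2r ?invr_ge0// ler_norm.
  by rewrite lerDl addr_ge0// sumr_ge0.
exists (fun k => psi k * (act k)%:R); split=> [k|i|].
- by rewrite mulr_ge0.
- by rewrite psiE; apply: eq_bigr => k _; rewrite mulrA.
(* Complementary slackness: only rows tight at [x] carry weight. *)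
rewrite (_ : c = fun i => \sum_k (psi k * (act k)%:R) * G k i); last first.
  by apply: funext => i; rewrite psiE; apply: eq_bigr => k _; rewrite mulrA.
rewrite dot_sum; apply: eq_bigr => k _.
by have [/eqP ->//|] := boolP (act k); rewrite mulr0 !mul0r.
Qed.

End Dot.

(** * Integral maximizers *)

Section Faces.
Variables (R : realType) (n : nat).
Implicit Types (A : set 'rV[R]_n) (c d : 'I_n -> R).

Definition face A c : set 'rV[R]_n :=
  [set x | A x /\ forall y, A y -> dot c (y ord0) <= dot c (x ord0)].

Definition zvec (z : 'I_n -> int) : 'I_n -> R := fun i => (z i)%:~R.

(** Integrality of the support function at integral vectors, read off at maximizers so that no
    supremum has to be taken. *)
Definition integral_support A : Prop :=
  forall (z : 'I_n -> int) x, face A (zvec z) x ->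
    dot (zvec z) (x ord0) \is a Num.int.

Lemma dot_continuous c : continuous (fun x : 'rV[R]_n => dot c (x ord0)).
Proof.
apply: continuous_big => [|i _]; first exact: add_continuous.
by move=> x; apply: (@cvgMl_tmp _ _ (nbhs x)); exact: coord_continuous.
Qed.

Lemma face_nonempty A c : A !=set0 -> compact A -> face A c !=set0.
Proof.
move=> A0 cA; have [x xA xmax] := EVT_max_rV A0 cA
  (continuous_subspaceT (@dot_continuous c)).
exists x; split; first by rewrite inE in xA.
by move=> y yA; apply: xmax; rewrite inE.
Qed.

Lemma face_compact A c : compact A -> compact (face A c).
Proof.
move=> cA; have [A0|/nonemptyPn A0] := pselect (A !=set0); last first.
  rewrite (_ : face A c = set0); first exact: compact0.
  by rewrite -subset0 => x []; rewrite A0.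
have [x [xA xmax]] := face_nonempty c A0 cA.
rewrite (_ : face A c = A `&` (fun y => dot c (y ord0)) @^-1`
    [set t | dot c (x ord0) <= t]).
  apply: compact_closedI => //; apply: preimage_closed; last exact: closed_ge.
  by move=> y _; exact: dot_continuous.
apply/seteqP; split=> y /= [yA ymax]; split=> //.
  exact: ymax.
by move=> z zA; apply: le_trans ymax; exact: xmax.
Qed.

(* The support function of a face is the directional derivative of the support
   function of [A]: [h_A (N c + d) - N h_A c] decreases to [h_(face A c) d]. *)
Lemma face_support_limit A c d x (e : R) : compact A -> face (face A c) d x ->
  0 < e -> exists (N : nat) (y : 'rV[R]_n), let c' := fun i => N%:R * c i + d i in
    [/\ face A c' y,
      dot d (x ord0) <= dot c' (y ord0) - N%:R * dot c (x ord0) &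
      dot c' (y ord0) - N%:R * dot c (x ord0) < dot d (x ord0) + e].
Proof.
move=> cA [[xA xmax] xdmax] e0.
have A0 : A !=set0 by exists x.
have dotE N y : dot (fun i => N%:R * c i + d i) y = N%:R * dot c y + dot d y.
  by rewrite -dotZl -dotDl.
suff [N hN] : exists N : nat, forall y, A y -> dot d (x ord0) + e <= dot d (y ord0) ->
    N%:R * dot c (y ord0) + dot d (y ord0) < N%:R * dot c (x ord0) + dot d (x ord0).
  have [y [yA ymax]] := face_nonempty (fun i => N%:R * c i + d i) A0 cA.
  exists N, y; split=> //; rewrite !dotE.
    by have := ymax _ xA; rewrite !dotE; lra.
  rewrite ltNge; apply/negP => h.
  have cxy : N%:R * dot c (y ord0) <= N%:R * dot c (x ord0).
    by rewrite ler_wpM2l//; exact: xmax.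
  have /(hN _ yA) : dot d (x ord0) + e <= dot d (y ord0) by lra.
  by have := ymax _ xA; rewrite !dotE; lra.
(* The points that beat [x] by [e] in direction [d] form a compact set missing the face of [c], so
   they lose at least some [D > 0] in direction [c], while their gain in [d] is at most [s]. *)
pose B := A `&` (fun y => dot d (y ord0)) @^-1` [set t | dot d (x ord0) + e <= t].
have [B0|/nonemptyPn B0] := pselect (B !=set0); last first.
  exists 0%N => y yA yd; have : B y by [].
  by rewrite B0.
have cB : compact B.
  apply: compact_closedI => //; apply: preimage_closed; last exact: closed_ge.
  by move=> y _; exact: dot_continuous.
have [u [[uA /= ud] umax]] := face_nonempty c B0 cB.
have [v [vA vmax]] := face_nonempty d A0 cA.
have cu : 0 < dot c (x ord0) - dot c (u ord0).
  rewrite subr_gt0 ltNge; apply/negP => h.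
  have /xdmax : face A c u.
    by split=> // y yA; apply: le_trans h; exact: xmax.
  by lra.
set D := _ - _ in cu; pose s := dot d (v ord0) - dot d (x ord0).
have [N sN] : exists N : nat, s / D < N%:R.
  by exists (Num.truncn (s / D)).+1; exact: truncnS_gt.
exists N => y yA yd; have /umax cy : B y by [].
have := vmax _ yA; rewrite ltr_pdivrMr// in sN.
have : N%:R * dot c (y ord0) <= N%:R * dot c (u ord0) by rewrite ler_wpM2l.
by move: sN; rewrite /s /D mulrBr; lra.
Qed.

Lemma face_integral_support A (z : 'I_n -> int) : compact A ->
  integral_support A -> integral_support (face A (zvec z)).
Proof.
move=> cA iA w x xf; set t := dot _ _.
have xz : dot (zvec z) (x ord0) \is a Num.int by apply: iA; case: xf.
have [tE|tE] := eqVneq t (Num.ceil t)%:~R; first by rewrite tE rpred_int.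
(* With this [e] the approximating integer would lie in [[t, ceil t)], which contains none. *)
have e0 : 0 < (Num.ceil t)%:~R - t.
  by rewrite subr_gt0 lt_neqAle tE ceil_ge.
have [N [y [yf y1 y2]]] := face_support_limit cA xf e0.
move: yf y1 y2; set c' := (fun i => _) => yf y1 y2.
have c'E : c' = zvec (fun i => N%:Z * z i + w i).
  by apply: funext => i; rewrite /zvec intrD intrM.
have : dot c' (y ord0) - N%:R * dot (zvec z) (x ord0) \is a Num.int.
  by rewrite rpredB ?rpredM ?rpred_nat// c'E; apply: iA; rewrite -c'E.
move/intrP => [q qE]; move: y1 y2; rewrite qE => y1 y2.
exfalso; move: y2; rewrite -/t addrC subrK ltr_int.
by rewrite ltNge ceil_le_int y1.
Qed.

Lemma integral_face_point A (z : 'I_n -> int) : A !=set0 -> compact A ->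
  integral_support A ->
  exists2 x, face A (zvec z) x & forall i, x ord0 i \is a Num.int.
Proof.
move=> A0 cA iA.
suff H k : (k <= n)%N -> exists B, [/\ B !=set0, compact B, integral_support B,
    B `<=` face A (zvec z) & forall x (i : 'I_n), B x -> (i < k)%N -> x ord0 i \is a Num.int].
  have [B [[x xB] _ _ /(_ x xB) xf Bint]] := H n (leqnn n).
  by exists x => // i; exact: Bint.
elim: k => [_|k IHk kn].
  exists (face A (zvec z)); split=> //.
  - exact: face_nonempty.
  - exact: face_compact.
  - exact: face_integral_support.
have [B [B0 cB iB BA Bint]] := IHk (ltnW kn).
(* On the face exposed by a unit vector that coordinate equals the support value, hence is an
   integer. *)
pose ko := Ordinal kn; pose e i : int := (i == ko)%:Z.
exists (face B (zvec e)); split.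
- exact: face_nonempty.
- exact: face_compact.
- exact: face_integral_support.
- by move=> x [/BA].
move=> x i xf; rewrite ltnS leq_eqVlt => /orP[/eqP ik|ik]; last first.
  by apply: Bint ik; case: xf.
have := iB _ _ xf; rewrite /dot (bigD1 ko)//= /zvec /e eqxx mul1r big1 ?addr0.
  by rewrite (_ : ko = i)//; apply: val_inj.
by move=> j /negPf ->; rewrite mul0r.
Qed.

End Faces.

Section IntegralMaximizers.
Variables (R : realType) (n : nat).

(** A primal maximizer yields a real dual optimum, so total dual integrality supplies an integral
    one; its objective is an integer because [b] is integral, and it equals the primal maximum. *)
Lemma TDI_integral_support (p : nat) (G : 'M[rat]_(p, n)) (b : 'cV[int]_p)
    (A : set 'rV[R]_n) :
  (forall x, A x <-> forall k, \sum_i ratr (G k i) * x ord0 i <= (b k ord0)%:~R) ->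
  TDI R n p G b -> integral_support A.
Proof.
move=> AE tdi z x [/AE xA xmax].
pose Gr k i : R := ratr (G k i).
have [y yA|psi [psi0 psiE psib]] :=
  @lp_duality R n p Gr (fun k => (b k ord0)%:~R) (zvec R z) (x ord0) xA.
  have := xmax (\row_i y i); rewrite (_ : (\row_i y i) ord0 = y).
    by apply; apply/AE => k; under eq_bigr do rewrite mxE; exact: yA.
  by apply: funext => i; rewrite mxE.
have opt psi' : (forall k, 0 <= psi' k) /\
    (forall i, \sum_k ratr (G k i) * psi' k = (z i)%:~R) ->
    dot (zvec R z) (x ord0) <= \sum_k psi' k * (b k ord0)%:~R.
  move=> [psi'0 psi'E].
  rewrite (_ : zvec R z = fun i => \sum_k psi' k * Gr k i).
    by rewrite dot_sum; apply: ler_sum => k _; rewrite ler_wpM2l//; exact: xA.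
  apply: funext => i; rewrite /zvec -psi'E.
  by apply: eq_bigr => k _; rewrite mulrC.
have feas : (forall k, 0 <= psi k) /\
    (forall i, \sum_k ratr (G k i) * psi k = (z i)%:~R).
  split=> // i; rewrite -[RHS]/(zvec R z i) psiE.
  by apply: eq_bigr => k _; rewrite mulrC.
have [|q [qint [qfeas qopt]]] := tdi z.
  by exists psi; split=> // psi' /opt; rewrite psib.
have -> : dot (zvec R z) (x ord0) = \sum_k q k * (b k ord0)%:~R.
  by apply/eqP; rewrite eq_le opt//= -psib qopt.
by apply: rpred_sum => k _; rewrite rpredM// rpred_int.
Qed.

(* Approximate [c] by [floor (N c) / N]; only finitely many integral points
   compete, so one of them is optimal in the limit. *)
Lemma integral_argmax (A : set 'rV[R]_n) (c : 'I_n -> R) :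
  A !=set0 -> compact A -> (forall x, A x -> forall i, 0 <= x ord0 i) ->
  integral_support A ->
  exists2 x, face A c x & forall i, x ord0 i \is a Num.int.
Proof.
move=> A0 cA Age0 iA.
(* The maximal coordinate sum [s] bounds every coordinate on [A], and also the total error of
   rounding the coefficients down. *)
have [u [uA umax]] := face_nonempty (fun=> 1) A0 cA.
set s := dot _ (u ord0) in umax.
have sumA x : A x -> \sum_i x ord0 i <= s.
  by move=> /umax; rewrite /dot; under eq_bigr do rewrite mul1r.
pose T : finType := {ffun 'I_n -> 'I_(Num.truncn s).+1}.
pose emb (t : T) : 'rV[R]_n := \row_i (t i)%:R.
have embP x : A x -> (forall i, x ord0 i \is a Num.int) -> exists t, x = emb t.
  move=> xA xint.
  have xi i : exists k : 'I_(Num.truncn s).+1, x ord0 i = k%:R.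
    have /natrP[k kE] : x ord0 i \is a Num.nat by rewrite natrEint xint Age0.
    have ks : (k < (Num.truncn s).+1)%N.
      rewrite -(ltr_nat R) -kE; apply: le_lt_trans (truncnS_gt s).
      apply: le_trans (sumA _ xA); rewrite (bigD1 i)//= lerDl.
      by apply: sumr_ge0 => j _; exact: Age0.
    by exists (Ordinal ks).
  have [t tE] := choice xi; exists [ffun i => t i].
  by apply/rowP => i; rewrite mxE ffunE -tE.
have [x0 [x0A _] x0int] := integral_face_point (fun=> 0) A0 cA iA.
have [t0 t0E] := embP _ x0A x0int.
pose P t := `[< A (emb t) >].
have Pt0 : P t0 by apply/asboolP; rewrite -t0E.
have [t /asboolP tA tmax] :=
  @arg_maxP _ _ _ t0 P (fun t => dot c (emb t ord0)) Pt0.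
exists (emb t); last by move=> i; rewrite mxE rpred_nat.
split=> // y yA; rewrite leNgt; apply/negP; rewrite -subr_gt0 => d0.
set d := _ - _ in d0.
(* For this [N] the scaled gap [N * d] exceeds the rounding error [s]. *)
pose N := (Num.truncn (s / d)).+1; have := truncnS_gt (s / d).
rewrite -/N ltr_pdivrMr// ltNge => /negP; apply.
pose z i := Num.floor (N%:R * c i).
have [x [xA xmax] xint] := integral_face_point z A0 cA iA.
have [tx xE] := embP _ xA xint.
have hx : N%:R * dot c (x ord0) <= N%:R * dot c (emb t ord0).
  rewrite ler_wpM2l// xE; apply: tmax; apply/asboolP; by rewrite -xE.
have zx : dot (zvec R z) (x ord0) <= N%:R * dot c (x ord0).
  rewrite -dotZl; apply: ler_sum => i _.
  by rewrite ler_wpM2r ?Age0// /zvec /z floor_le.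
have zy : N%:R * dot c (y ord0) <= dot (zvec R z) (y ord0) + \sum_i y ord0 i.
  rewrite -dotZl -big_split; apply: ler_sum => i _ /=.
  rewrite -[X in _ + X]mul1r -mulrDl ler_wpM2r ?Age0// /zvec /z.
  by have := ltW (floorD1_gt (N%:R * c i)); rewrite intrD.
have := sumA _ yA; have := xmax _ yA; rewrite /d mulrBr; lra.
Qed.

End IntegralMaximizers.

(** * Ironing *)

Section Convex01.
Variable R : realType.
Implicit Types (h : R -> R) (a b c : R).

(** The three-slope inequality, cross-multiplied to avoid quotients. *)
Lemma convex01_chord h a b c : convex01 R h -> 0 <= a -> a < b -> b < c -> c <= 1 ->
  (h b - h a) * (c - b) <= (h c - h b) * (b - a).
Proof.
move=> ch a0 ab bc c1.
have ca : 0 < c - a by lra.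
pose t := (c - b) / (c - a).
have tE : t * (c - a) = c - b by rewrite /t divfK// gt_eqF.
have t0 : 0 <= t by rewrite divr_ge0; lra.
have t1 : t <= 1 by rewrite /t ler_pdivrMr//; lra.
have bE : t * a + (1 - t) * c = b by move: tE; rewrite mulrBr mulrBl mul1r; lra.
have hb : h b <= t * h a + (1 - t) * h c.
  by rewrite -{1}bE; apply: ch; apply/andP; split; lra.
have : h b * (c - a) <= (t * h a + (1 - t) * h c) * (c - a) by rewrite ler_wpM2r// ltW.
have -> : (t * h a + (1 - t) * h c) * (c - a) =
  (t * (c - a)) * h a + (c - a - t * (c - a)) * h c by ring.
by rewrite tE; lra.
Qed.

Lemma convex01_max h h' : convex01 R h -> convex01 R h' ->
  convex01 R (fun x => Num.max (h x) (h' x)).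
Proof.
move=> ch ch' x y t hx hy ht; have /andP[t0 t1] := ht.
have t1' : 0 <= 1 - t by lra.
rewrite ge_max; apply/andP; split.
  by apply: le_trans (ch _ _ _ hx hy ht) _; rewrite lerD// ler_wpM2l// le_max lexx.
by apply: le_trans (ch' _ _ _ hx hy ht) _; rewrite lerD// ler_wpM2l// le_max lexx orbT.
Qed.

Lemma convex01_affine p s : convex01 R (fun x => p + s * x).
Proof.
move=> x y t _ _ _; rewrite le_eqVlt; apply/orP; left; apply/eqP; ring.
Qed.

(* Convexity on a closed interval allows upward jumps at the endpoints. *)
Lemma convex01_endpoint e (p q : R) : (e == 0) || (e == 1) -> q <= p ->
  convex01 R (fun x => if x == e then p else q).
Proof.
move=> he qp x y t /andP[x0 x1] /andP[y0 y1] /andP[t0 t1].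
have t1' : 0 <= 1 - t by lra.
pose h z := if z == e then p else q.
rewrite -/(h x) -/(h y).
have hq z : q <= h z by rewrite /h; case: ifP.
case: ifP => [/eqP E|_]; last first.
  rewrite (_ : q = t * q + (1 - t) * q); last by ring.
  by rewrite lerD// ler_wpM2l.
(* An endpoint is an extreme point: a convex combination reaches it only trivially. *)
have [tx ty] : t * (x - e) = 0 /\ (1 - t) * (y - e) = 0.
  have m1 := mulr_ge0 t0 x0; have m2 := mulr_ge0 t1' y0.
  have m3 : 0 <= t * (1 - x) by rewrite mulr_ge0//; lra.
  have m4 : 0 <= (1 - t) * (1 - y) by rewrite mulr_ge0//; lra.
  move: m1 m2 m3 m4 E; rewrite !mulrBr mulr1.
  by case/orP: he => /eqP ->; split; lra.
have hE s z : s * (z - e) = 0 -> s * h z = s * p.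
  move=> /eqP; rewrite mulf_eq0 subr_eq0 => /orP[/eqP ->|/eqP ->].
    by rewrite !mul0r.
  by rewrite /h eqxx.
by rewrite (hE _ _ tx) (hE _ _ ty); lra.
Qed.

Lemma affine_le p s q t a b z : a < b -> a <= z -> z <= b ->
  p + s * a <= q + t * a -> p + s * b <= q + t * b -> p + s * z <= q + t * z.
Proof.
move=> ab az zb ha hb.
have m1 : 0 <= (b - z) * (q + t * a - (p + s * a)) by rewrite mulr_ge0//; lra.
have m2 : 0 <= (z - a) * (q + t * b - (p + s * b)) by rewrite mulr_ge0//; lra.
have E : (b - z) * (q + t * a - (p + s * a)) + (z - a) * (q + t * b - (p + s * b)) =
  (b - a) * (q + t * z - (p + s * z)) by ring.
rewrite -subr_ge0 -(pmulr_rge0 _ (_ : 0 < b - a)); last by lra.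
by rewrite -E addr_ge0.
Qed.

End Convex01.

(** * The lower convex envelope at the grid points *)

Section Ironing.
Variables (R : realType) (n : nat) (K : 'I_n -> nat) (val f : forall i : 'I_n, nat -> R).
Variables (alpha : R) (i : 'I_n).
Hypothesis f_gt0 : forall j, (j < K i)%N -> 0 < f i j.
Hypothesis f_sum1 : \sum_(j < K i) f i j = 1.

Local Notation F := (Fpt R n f i).
Local Notation S := (Spt R n K val f alpha i).
Local Notation Sint := (Sint R n K val f alpha i).
Local Notation H := (Henv R n K val f alpha i).
Local Notation phibar := (phibar R n K val f alpha i).

Lemma FptS k : F k.+1 = F k + f i k.
Proof. by rewrite /Fpt big_ord_recr. Qed.

Lemma SptS k : S k.+1 = S k + phi R n K val f alpha i k * f i k.
Proof. by rewrite /Spt big_ord_recr. Qed.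

Lemma Fpt0 : F 0 = 0. Proof. by rewrite /Fpt big_ord0. Qed.

Lemma Fpt_ltS k : (k < K i)%N -> F k < F k.+1.
Proof. by move=> /f_gt0 fk; rewrite FptS ltrDl. Qed.

Lemma Fpt_le j k : (j <= k)%N -> (k <= K i)%N -> F j <= F k.
Proof.
elim: k => [|k IHk]; first by rewrite leqn0 => /eqP ->.
rewrite leq_eqVlt => /orP[/eqP ->//|]; rewrite ltnS => jk kK.
by apply: le_trans (ltW (Fpt_ltS kK)); exact: IHk (ltnW kK).
Qed.

Lemma Fpt_01 k : (k <= K i)%N -> 0 <= F k <= 1.
Proof.
by move=> kK; rewrite -{1}Fpt0 -f_sum1 -[\sum_(_ < _) _]/(F (K i)) !Fpt_le.
Qed.

(** In the clamped sum, segments left of [k] contribute their whole increment and segments right of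
    [k] contribute 0. *)
Lemma Sint_segment k x : (k < K i)%N -> F k <= x -> x <= F k.+1 ->
  Sint x = S k + (S k.+1 - S k) / (F k.+1 - F k) * (x - F k).
Proof.
move=> kK Fkx xFk.
rewrite /Defs.Sint (eq_bigr (fun l : 'I_(K i) =>
   (if (l < k)%N then phi R n K val f alpha i l * f i l else 0) +
   (if l == Ordinal kK then (S k.+1 - S k) / (F k.+1 - F k) * (x - F k) else 0))).
  rewrite big_split -!big_mkcond big_pred1_eq; congr (_ + _).
  rewrite /Spt.
  by rewrite (big_ord_widen (K i) (fun l => phi R n K val f alpha i l * f i l) (ltnW kK)).
move=> l _; have Fl := Fpt_ltS (ltn_ord l).
case: (ltngtP l k) => lk.
- rewrite ifF; last by apply/negbTE; rewrite -val_eqE /= neq_ltn lk.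
  have lx : F l.+1 <= x by apply: le_trans Fkx; exact: Fpt_le (ltnW kK).
  rewrite max_l; last exact: le_trans (ltW Fl) lx.
  rewrite min_r// divfK; last by rewrite subr_eq0 gt_eqF.
  by rewrite SptS addr0; ring.
- rewrite ifF; last by apply/negbTE; rewrite -val_eqE /= neq_ltn lk orbT.
  have xl : x <= F l by apply: le_trans xFk _; exact: Fpt_le (ltnW (ltn_ord l)).
  by rewrite max_r// min_l ?(ltW Fl)// subrr mulr0 addr0.
- have -> : l = Ordinal kK by apply: val_inj.
  by rewrite eqxx /= max_l// min_l// add0r.
Qed.

Lemma Sint_Fpt k : (k <= K i)%N -> Sint (F k) = S k.
Proof.
rewrite leq_eqVlt => /orP[/eqP|kK]; last first.
  by rewrite (Sint_segment kK) ?lexx ?(ltW (Fpt_ltS kK))// subrr mulr0 addr0.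
(* The last grid point is the right end of the last segment; [K i = 0] would contradict [f_sum1]. *)
case: k => [|k] kE.
  have /eqP := f_sum1; rewrite -kE big_ord0 eq_sym oner_eq0 //.
have kK : (k < K i)%N by rewrite -kE.
rewrite (Sint_segment kK) ?lexx ?(ltW (Fpt_ltS kK))// divfK.
  by rewrite addrC subrK.
by rewrite subr_eq0 gt_eqF// Fpt_ltS.
Qed.

Lemma Sint_lower_bound : exists m, forall x, m <= Sint x.
Proof.
exists (\sum_(k < K i) - (`|(S k.+1 - S k) / (F k.+1 - F k)| * (F k.+1 - F k))) => x.
apply: ler_sum => k _; set s := _ / _; set t := Num.min _ _ - _.
have Fk := ltW (Fpt_ltS (ltn_ord k)).
have t0 : 0 <= t by rewrite subr_ge0 le_min Fk andbT le_max lexx orbT.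
have t1 : t <= F k.+1 - F k by rewrite lerD2r ge_min lexx orbT.
apply: le_trans (_ : - (`|s| * t) <= _); first by rewrite lerN2 ler_wpM2l.
by rewrite -mulNr ler_wpM2r// lerNl -normrN ler_norm.
Qed.

Definition convex_minorant (h : R -> R) : Prop :=
  convex01 R h /\ forall z, 0 <= z <= 1 -> h z <= Sint z.

(** A constant lower bound raised to [Sint e] at the endpoint stays convex. Such minorants make the
    supremum in [Henv] range over a nonempty set and make the envelope touch [S] at both ends. *)
Lemma endpoint_minorant e : (e == 0) || (e == 1) ->
  exists2 h, convex_minorant h & h e = Sint e.
Proof.
move=> he; have [m mS] := Sint_lower_bound.
exists (fun x => if x == e then Sint e else m); last by rewrite eqxx.
split; first exact: convex01_endpoint.
by move=> z _; case: ifP => [/eqP ->|_].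
Qed.

Lemma Henv_le x y : (forall h, convex_minorant h -> h x <= y) -> H x <= y.
Proof.
move=> hy; apply: ge_sup.
  have [|h [ch hS] _] := @endpoint_minorant 0; first by rewrite eqxx.
  by exists (h x), h.
by move=> _ [h [ch hS ->]]; exact: hy.
Qed.

Lemma Henv_ge h x : 0 <= x <= 1 -> convex_minorant h -> h x <= H x.
Proof.
move=> x01 [ch hS]; apply: ub_le_sup; last by exists h.
by exists (Sint x) => _ [h' [_ h'S ->]]; exact: h'S.
Qed.

Lemma Henv_minorant : convex_minorant H.
Proof.
split=> [x y t x01 y01 t01|z z01]; last by apply: Henv_le => h [_]; exact.
apply: Henv_le => h hm; have /andP[t0 t1] := t01.
apply: le_trans (hm.1 _ _ _ x01 y01 t01) _.
by rewrite lerD// ler_wpM2l ?subr_ge0//; exact: Henv_ge.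
Qed.

Lemma Henv_le_Spt k : (k <= K i)%N -> H (F k) <= S k.
Proof. by move=> kK; rewrite -Sint_Fpt// Henv_minorant.2// Fpt_01. Qed.

Lemma Henv_endpoint e : (e == 0) || (e == 1) -> H e = Sint e.
Proof.
move=> he; have e01 : 0 <= e <= 1.
  by case/orP: he => /eqP ->; rewrite ?lexx ler01.
apply/eqP; rewrite eq_le Henv_minorant.2//=.
by have [h hm <-] := endpoint_minorant he; exact: Henv_ge.
Qed.

Lemma Henv_Fpt0 : H (F 0) = S 0.
Proof. by rewrite -Sint_Fpt// Henv_endpoint// Fpt0 eqxx. Qed.

Lemma Henv_FptK : H (F (K i)) = S (K i).
Proof. by rewrite -Sint_Fpt// Henv_endpoint// /Fpt f_sum1 eqxx orbT. Qed.

Lemma phibar_f k : (k < K i)%N -> phibar k * f i k = H (F k.+1) - H (F k).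
Proof.
by move=> kK; rewrite /Defs.phibar {2}FptS addrAC subrr add0r divfK// gt_eqF// f_gt0.
Qed.

Lemma phibar_leS k : (k.+1 < K i)%N -> phibar k <= phibar k.+1.
Proof.
move=> kK; have ab := Fpt_ltS (ltnW kK); have bc := Fpt_ltS kK.
have /andP[a0 _] := Fpt_01 (ltnW (ltnW kK)); have /andP[_ c1] := Fpt_01 kK.
rewrite /Defs.phibar ler_pdivrMr ?subr_gt0// mulrAC ler_pdivlMr ?subr_gt0//.
exact: convex01_chord Henv_minorant.1 a0 ab bc c1.
Qed.

(* Where the envelope is strictly below [S], it could be raised above the
   grid point by a chord if its slope changed there. *)
Lemma phibar_flat k : (k.+1 < K i)%N -> H (F k.+1) < S k.+1 ->
  phibar k = phibar k.+1.
Proof.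
move=> kK HS; apply/eqP; rewrite eq_le phibar_leS//= leNgt; apply/negP => lt_phi.
have ab := Fpt_ltS (ltnW kK); have bc := Fpt_ltS kK.
have a01 := Fpt_01 (ltnW (ltnW kK)); have c01 := Fpt_01 kK.
have b01 := Fpt_01 (ltnW kK).
have chord := convex01_chord Henv_minorant.1.
have Sab := Sint_segment (ltnW kK); have Sbc := Sint_segment kK.
have HSa := Henv_le_Spt (ltnW (ltnW kK)); have HSc := Henv_le_Spt kK.
have Sa := Sint_Fpt (ltnW (ltnW kK)); have Sb := Sint_Fpt (ltnW kK).
have Sc := Sint_Fpt kK.
move: lt_phi; rewrite /Defs.phibar ltr_pdivrMr ?subr_gt0// mulrAC ltr_pdivlMr ?subr_gt0//.
move: ab bc a01 b01 c01 HS HSa HSc Sab Sbc Sa Sb Sc.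
set a := F k; set b := F k.+1; set c := F k.+2.
move=> ab bc /andP[a0 a1] /andP[b0 b1] /andP[c0 c1] HS HSa HSc Sab Sbc Sa Sb Sc lt_chord.
have ac : 0 < c - a by lra.
pose s := (H c - H a) / (c - a).
have sE : s * (c - a) = H c - H a by rewrite divfK// gt_eqF.
(* The chord of [H] over [[a, c]] is lowered by [d], just enough not to exceed [S] at [b]; it stays
   strictly above [H b]. *)
pose d := Num.max 0 (H a + s * (b - a) - S k.+1).
have d0 : 0 <= d by rewrite le_max lexx.
have dS : H a + s * (b - a) - S k.+1 <= d by rewrite le_max lexx orbT.
pose p := H a - s * a - d.
have La : p + s * a <= H a by rewrite /p; lra.
have Lc : p + s * c <= H c by move: sE; rewrite /p mulrBr; lra.
have Lb : p + s * b <= S k.+1 by move: dS; rewrite /p mulrBr; lra.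
have HbL : H b < p + s * b.
  have Hb : H b < H a + s * (b - a).
    rewrite -(ltr_pM2r ac) mulrDl mulrAC sE; lra.
  move: Hb; rewrite /p /d /Num.max; case: ifP; rewrite mulrBr => _ ?; lra.
suff /(Henv_ge (x := b)) : convex_minorant (fun x => Num.max (H x) (p + s * x)).
  by rewrite b0 b1 => /(_ isT); rewrite ge_max lexx /= leNgt HbL.
split; first by apply: convex01_max; [exact: Henv_minorant.1|exact: convex01_affine].
move=> z z01; have HSz := Henv_minorant.2 z z01; rewrite ge_max HSz /=.
have [z0 z1] := andP z01.
(* Left of [a] the line is below [H]: otherwise the convex function [H] minus the line would be
   negative at [z] and [b] but nonnegative at [a] between them. The case right of [c] is
   symmetric. *)
have [za|az] := ltP z a.
  apply: le_trans HSz; rewrite leNgt; apply/negP => Lz.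
  have := chord z a b z0 za ab b1.
  have m1 : 0 <= (b - z) * (H a - (p + s * a)) by rewrite mulr_ge0//; lra.
  have m2 : 0 < (b - a) * (p + s * z - H z) by rewrite mulr_gt0//; lra.
  have m3 : 0 < (a - z) * (p + s * b - H b) by rewrite mulr_gt0//; lra.
  move: m1 m2 m3; lra.
(* On each of the two segments [Sint] is affine, so comparing at the ends suffices. *)
have [zb|bz] := leP z b.
  rewrite Sab// -/a -/b; set t := _ / _.
  rewrite (_ : S k + t * (z - a) = (S k - t * a) + t * z); last by ring.
  have St x : a <= x -> x <= b -> Sint x = S k - t * a + t * x.
    by move=> ax xb; rewrite Sab// -/t; ring.
  apply: (affine_le ab az zb); rewrite -St ?lexx ?(ltW ab)//.
    by rewrite Sa; lra.
  by rewrite Sb.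
have [zc|cz] := leP z c.
  rewrite Sbc// -/b -/c ?(ltW bz)//; set t := _ / _.
  rewrite (_ : S k.+1 + t * (z - b) = (S k.+1 - t * b) + t * z); last by ring.
  have St x : b <= x -> x <= c -> Sint x = S k.+1 - t * b + t * x.
    by move=> ax xb; rewrite Sbc// -/t; ring.
  apply: (affine_le bc (ltW bz) zc); rewrite -St ?lexx ?(ltW bc)//.
    by rewrite Sb.
  by rewrite Sc; lra.
apply: le_trans HSz; rewrite leNgt; apply/negP => Lz.
have := chord b c z b0 bc cz z1.
have m1 : 0 <= (z - b) * (H c - (p + s * c)) by rewrite mulr_ge0//; lra.
have m2 : 0 < (c - b) * (p + s * z - H z) by rewrite mulr_gt0//; lra.
have m3 : 0 < (z - c) * (p + s * b - H b) by rewrite mulr_gt0//; lra.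
move: m1 m2 m3; lra.
Qed.

End Ironing.

(** * Single-bidder sums *)

Section Sums.
Variable R : realFieldType.
Implicit Types a d v : nat -> R.

(** Exchange of summation order; for a pmf the last factor is the tail probability appearing in
    [phi]. *)
Lemma sum_partial_sums (f x : nat -> R) N :
  \sum_(k < N) f k * (\sum_(l < k) x l) =
  \sum_(l < N) x l * (\sum_(j < N) f j - \sum_(j < l.+1) f j).
Proof.
elim: N => [|N IHN]; first by rewrite !big_ord0.
rewrite big_ord_recr IHN [RHS]big_ord_recr /= subrr mulr0 addr0 mulr_sumr -big_split.
apply: eq_bigr => l _ /=.
by rewrite [in RHS]big_ord_recr /=; ring.
Qed.

Lemma abel_summation d a N :
  \sum_(k < N.+1) (d k.+1 - d k) * a k =
  d N.+1 * a N - d 0%N * a 0%N + \sum_(k < N) d k.+1 * (a k - a k.+1).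
Proof.
elim: N => [|N IHN]; first by rewrite big_ord1 big_ord0; ring.
by rewrite big_ord_recr IHN [in RHS]big_ord_recr /=; ring.
Qed.

(** The information rent: the discrete integral of the allocation over lower values. *)
Definition rent v a k := \sum_(l < k) (v l.+1 - v l) * a l.

Lemma rentS v a k : rent v a k.+1 = rent v a k + (v k.+1 - v k) * a k.
Proof. by rewrite /rent big_ord_recr. Qed.

Section Monotone.
Variables (v a : nat -> R) (N : nat).
Hypothesis v_le : forall k, (k.+1 < N)%N -> v k <= v k.+1.
Hypothesis a_le : forall k, (k.+1 < N)%N -> a k <= a k.+1.

Lemma alloc_le j k : (j <= k)%N -> (k < N)%N -> a j <= a k.
Proof.
elim: k => [|k IHk]; first by rewrite leqn0 => /eqP ->.
rewrite leq_eqVlt => /orP[/eqP ->//|]; rewrite ltnS => jk kN.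
exact: le_trans (IHk jk (ltnW kN)) (a_le kN).
Qed.

Lemma rent_underbid k t : (k <= t)%N -> (t < N)%N ->
  a k * (v t - v k) <= rent v a t - rent v a k.
Proof.
elim: t => [|t IHt]; first by rewrite leqn0 => /eqP ->; rewrite !subrr mulr0.
rewrite leq_eqVlt => /orP[/eqP ->|]; first by rewrite !subrr mulr0.
rewrite ltnS => kt tN; rewrite rentS.
have m : 0 <= (v t.+1 - v t) * (a t - a k).
  by rewrite mulr_ge0// subr_ge0 ?v_le//; exact: alloc_le kt (ltnW tN).
by have := IHt kt (ltnW tN); move: m; lra.
Qed.

(** The bound [c] stays fixed during the induction on [k]; it is later instantiated with [a k]. *)
Lemma rent_overbid_le c k t : (t <= k)%N -> (k < N)%N ->
  (forall l, (l < k)%N -> a l <= c) ->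
  rent v a k - rent v a t <= c * (v k - v t).
Proof.
elim: k => [|k IHk]; first by rewrite leqn0 => /eqP ->; rewrite !subrr mulr0.
rewrite leq_eqVlt => /orP[/eqP ->|]; first by rewrite !subrr mulr0.
rewrite ltnS => tk kN ac; rewrite rentS.
have m : 0 <= (v k.+1 - v k) * (c - a k).
  by rewrite mulr_ge0// subr_ge0 ?v_le ?ac.
have := IHk tk (ltnW kN) (fun l lk => ac l (ltnW lk)); move: m; lra.
Qed.

Lemma rent_truthful k t : (k < N)%N -> (t < N)%N ->
  a k * v t - (v k * a k - rent v a k) <= a t * v t - (v t * a t - rent v a t).
Proof.
move=> kN tN; have [kt|/ltnW tk] := leqP k t.
  by have := rent_underbid kt tN; lra.
have := rent_overbid_le tk kN (fun l lk => alloc_le (ltnW lk) kN); lra.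
Qed.

End Monotone.

(** Each deviation to the next lower value lets the payment rise by at most
    [v k.+1 * (a k.+1 - a k)]; these bounds telescope from participation at the lowest value. *)
Lemma local_ic_pay_bound v a (p : nat -> R) N :
  ((0 < N)%N -> 0 <= a 0%N * v 0%N - p 0%N) ->
  (forall k, (k.+1 < N)%N ->
     a k * v k.+1 - p k <= a k.+1 * v k.+1 - p k.+1) ->
  forall k, (k < N)%N -> p k <= v k * a k - rent v a k.
Proof.
move=> ir ic; elim=> [|k IHk] kN.
  by have := ir kN; rewrite /rent big_ord0; lra.
have := ic _ kN; have := IHk (ltnW kN); rewrite rentS; lra.
Qed.

End Sums.

(** * Generalized and ironed virtual welfare of one bidder *)

Section VirtualValues.
Variables (R : realType) (n : nat) (K : 'I_n -> nat) (val f : forall i : 'I_n, nat -> R).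
Variables (alpha : R) (i : 'I_n).
Hypothesis f_gt0 : forall j, (j < K i)%N -> 0 < f i j.
Hypothesis f_sum1 : \sum_(j < K i) f i j = 1.

Local Notation phi := (phi R n K val f alpha i).
Local Notation phibar := (phibar R n K val f alpha i).

(** Removes the case split in [phi]: at the top value the tail probability is 0 and cancels the
    out-of-range [val i k.+1]. *)
Lemma phi_f k : (k < K i)%N -> phi k * f i k =
  val i k * f i k - alpha * (val i k.+1 - val i k) * (1 - \sum_(j < k.+1) f i j).
Proof.
move=> kK; rewrite /Defs.phi /cdf; case: ifP => [_|/negbT].
  by rewrite mulrBl divfK// gt_eqF// f_gt0.
rewrite -leqNgt => Kk; have -> : k.+1 = K i by apply/eqP; rewrite eqn_leq kK.
by rewrite f_sum1 subrr mulr0 subr0.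
Qed.

(** Myerson's identity: exchanging sums turns the expected rent into the tail term of [phi]. *)
Lemma virtual_welfare (a : nat -> R) :
  alpha * (\sum_(k < K i) f i k * (val i k * a k - rent (val i) a k)) +
  (1 - alpha) * (\sum_(k < K i) val i k * f i k * a k) =
  \sum_(k < K i) phi k * f i k * a k.
Proof.
rewrite (eq_bigr (fun k : 'I_(K i) => val i k * f i k * a k -
  f i k * rent (val i) a k)); last by move=> k _; ring.
rewrite sumrB (sum_partial_sums (f i) (fun l => (val i l.+1 - val i l) * a l)).
rewrite f_sum1.
rewrite [RHS](eq_bigr (fun k : 'I_(K i) => val i k * f i k * a k - alpha *
  ((val i k.+1 - val i k) * a k * (1 - \sum_(j < k.+1) f i j)))).
  by rewrite sumrB -mulr_sumr; ring.
by move=> k _; rewrite phi_f//; ring.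
Qed.

Lemma ironed_welfare (a : nat -> R) :
  \sum_(k < K i) phi k * f i k * a k = \sum_(k < K i) phibar k * f i k * a k +
  \sum_(k < (K i).-1) (Spt R n K val f alpha i k.+1 -
    Henv R n K val f alpha i (Fpt R n f i k.+1)) * (a k - a k.+1).
Proof.
(* The gap [d] vanishes at both ends, so Abel summation leaves interior terms only. *)
pose d k := Spt R n K val f alpha i k - Henv R n K val f alpha i (Fpt R n f i k).
have d0 : d 0%N = 0 by rewrite /d Henv_Fpt0 ?subrr.
have dK : d (K i) = 0 by rewrite /d Henv_FptK ?subrr.
apply/eqP; rewrite addrC -subr_eq; apply/eqP.
transitivity (\sum_(k < K i) (d k.+1 - d k) * a k).
  rewrite -sumrB; apply: eq_bigr => k _; rewrite phibar_f// /d SptS; ring.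
case: (K i) dK => [|N] dN; first by rewrite !big_ord0.
by rewrite abel_summation dN d0 !mul0r subrr add0r.
Qed.

Lemma ironed_welfare_ge (a : nat -> R) :
  (forall k, (k.+1 < K i)%N -> a k <= a k.+1) ->
  \sum_(k < K i) phi k * f i k * a k <= \sum_(k < K i) phibar k * f i k * a k.
Proof.
move=> a_le; rewrite ironed_welfare gerDl; apply: sumr_le0 => k _.
have kK : (k.+1 < K i)%N by rewrite -ltn_predRL.
apply: mulr_ge0_le0; last by rewrite subr_le0 a_le.
by rewrite subr_ge0 Henv_le_Spt// ltnW.
Qed.

(** At each interior grid point either [S] and [H] agree, or the ironed value is constant there and
    so is [a]. *)
Lemma ironed_welfare_eq (a : nat -> R) :
  (forall k, (k.+1 < K i)%N -> phibar k = phibar k.+1 -> a k = a k.+1) ->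
  \sum_(k < K i) phi k * f i k * a k = \sum_(k < K i) phibar k * f i k * a k.
Proof.
move=> a_eq; rewrite ironed_welfare [X in _ + X]big1 ?addr0// => k _.
have kK : (k.+1 < K i)%N by rewrite -ltn_predRL.
have := Henv_le_Spt val alpha f_gt0 f_sum1 (ltnW kK); rewrite le_eqVlt => /orP[/eqP ->|HS].
  by rewrite subrr mul0r.
by rewrite (a_eq _ kK) ?subrr ?mulr0//; exact: phibar_flat.
Qed.

End VirtualValues.

(** * Auctions *)

Section Profiles.
Variables (n : nat) (K : 'I_n -> nat).
Implicit Types (w : prof n K) (i : 'I_n).

Lemma upd_same w i k : upd n K w i k i = k.
Proof. by rewrite ffunE; case: eqP => // e; rewrite (eq_irrelevance e erefl). Qed.

Lemma upd_other w i k j : j != i -> upd n K w i k j = w j.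
Proof. by rewrite ffunE eq_sym; case: eqP. Qed.

Lemma upd_upd w i k l : upd n K (upd n K w i k) i l = upd n K w i l.
Proof.
apply/ffunP => j; have [->|ji] := eqVneq j i; first by rewrite !upd_same.
by rewrite !upd_other.
Qed.

Lemma upd_id w i : upd n K w i (w i) = w.
Proof.
apply/ffunP => j; have [->|ji] := eqVneq j i; first by rewrite !upd_same.
by rewrite !upd_other.
Qed.

(** Resetting coordinate [i] is a bijection between the two index sets; it compares interim sums for
    different reports over the same opponents. *)
Lemma sum_upd (V : nmodType) i (k l : 'I_(K i)) (X : prof n K -> V) :
  \sum_(w : prof n K | w i == l) X w =
  \sum_(w : prof n K | w i == k) X (upd n K w i l).
Proof.
rewrite (reindex_onto (fun w => upd n K w i l) (fun w => upd n K w i k)).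
  apply: eq_bigl => w; rewrite upd_same eqxx /= upd_upd.
  apply/eqP/eqP => [<-|<-]; first by rewrite upd_same.
  by rewrite upd_id.
by move=> w /eqP <-; rewrite upd_upd upd_id.
Qed.

End Profiles.

(** * Interim allocations and payments *)

Section Interim.
Variables (R : realType) (n : nat) (K : 'I_n -> nat) (val f : forall i : 'I_n, nat -> R).
Hypothesis f_gt0 : forall i j, (j < K i)%N -> 0 < f i j.

Local Notation prof := (prof n K).
Local Notation auction := (auction R n K).
Local Notation alloc := (alloc R n K).
Local Notation pay := (pay R n K).
Local Notation upd := (upd n K).

(** The pmf of the opponents' values, taken on full profiles to avoid a type of partial ones. *)
Definition others_weight (i : 'I_n) (w : prof) : R := \prod_(j | j != i) f j (w j).

Lemma others_weight_ge0 i w : 0 <= others_weight i w.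
Proof. by apply: prodr_ge0 => j _; rewrite ltW// f_gt0. Qed.

Lemma others_weight_upd i w k : others_weight i (upd w i k) = others_weight i w.
Proof. by apply: eq_bigr => j ji; rewrite upd_other. Qed.

Lemma weight_ge0 (w : prof) : 0 <= weight R n K f w.
Proof. by apply: prodr_ge0 => j _; rewrite ltW// f_gt0. Qed.

Lemma Ex_others i (X : prof -> R) : Ex R n K f X =
  \sum_(k < K i) f i k * \sum_(w : prof | w i == k) others_weight i w * X w.
Proof.
rewrite /Ex (partition_big (fun w : prof => w i) predT)//; apply: eq_bigr => k _.
rewrite mulr_sumr; apply: eq_bigr => w /eqP <-.
by rewrite /weight (bigD1 i)//= mulrA.
Qed.

Lemma Ex_sum (X : prof -> 'I_n -> R) :
  Ex R n K f (fun w => \sum_i X w i) = \sum_i Ex R n K f (X^~ i).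
Proof.
rewrite /Ex exchange_big /=; apply: eq_bigr => w _; exact: mulr_sumr.
Qed.

(* Out of range indices get the interim allocation [0] of the empty bid. *)
Definition nat_alloc (M : auction) i (k : nat) : R := interimA R n K f M i (insub k).
Definition nat_pay (M : auction) i (k : nat) : R := interimP R n K f M i (insub k).

Lemma nat_allocE M i (k : 'I_(K i)) : nat_alloc M i k =
  \sum_(w : prof | w i == k) others_weight i w * alloc M w i.
Proof. by rewrite /nat_alloc valK. Qed.

Lemma nat_payE M i (k : 'I_(K i)) : nat_pay M i k =
  \sum_(w : prof | w i == k) others_weight i w * pay M w i.
Proof. by rewrite /nat_pay valK. Qed.

Lemma Rev_interim M :
  Rev R n K f M = \sum_i \sum_(k < K i) f i k * nat_pay M i k.
Proof.
rewrite /Rev Ex_sum; apply: eq_bigr => i _; rewrite (Ex_others i).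
by apply: eq_bigr => k _; rewrite nat_payE.
Qed.

Lemma Ex_welfare_interim M (c : 'I_n -> nat -> R) :
  Ex R n K f (fun w => \sum_i c i (w i) * alloc M w i) =
  \sum_i \sum_(k < K i) c i k * f i k * nat_alloc M i k.
Proof.
rewrite Ex_sum; apply: eq_bigr => i _; rewrite (Ex_others i).
apply: eq_bigr => k _; rewrite nat_allocE [c i k * _]mulrC -mulrA; congr (_ * _).
by rewrite mulr_sumr; apply: eq_bigr => w /eqP <-; rewrite mulrCA.
Qed.

Lemma Obj_interim alpha M : Obj R n K val f alpha M =
  \sum_i (alpha * (\sum_(k < K i) f i k * nat_pay M i k) +
    (1 - alpha) * (\sum_(k < K i) val i k * f i k * nat_alloc M i k)).
Proof.
rewrite /Obj Rev_interim big_split /= -!mulr_sumr; congr (_ + _ * _).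
rewrite -Ex_welfare_interim; apply: eq_bigr => w _; congr (_ * _).
by apply: eq_bigr => i _; rewrite mulrC.
Qed.

(** The ex post constraints are averaged over the opponents, with [sum_upd] aligning the deviating
    report with the true one. *)
Lemma DSIC_BIC M : DSIC R n K val M -> BIC R n K val f M.
Proof.
move=> ds i k b.
have utilE l : interimA R n K f M i (Some l) * val i k - interimP R n K f M i (Some l) =
    \sum_(w : prof | w i == k) others_weight i w *
      util R n K M i (Some l) w (val i k).
  rewrite mulr_suml -sumrB (sum_upd k l); apply: eq_bigr => w _.
  by rewrite -/(others_weight _ _) others_weight_upd /util; ring.
rewrite utilE; case: b => [l|].
  rewrite utilE; apply: ler_sum => w /eqP <-.
  by apply: ler_wpM2l; [exact: others_weight_ge0|exact: ds].
rewrite mul0r subrr; apply: sumr_ge0 => w /eqP <-.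
by apply: mulr_ge0; [exact: others_weight_ge0|exact: (ds i w None)].
Qed.

Section BIC.
Variable M : auction.
Hypothesis bic : BIC R n K val f M.

Lemma BIC_nat i k l : (k < K i)%N -> (l < K i)%N ->
  nat_alloc M i l * val i k - nat_pay M i l <=
  nat_alloc M i k * val i k - nat_pay M i k.
Proof.
move=> kK lK; have := @bic i (Ordinal kK) (Some (Ordinal lK)).
by rewrite /nat_alloc /nat_pay (insubT (fun x => x < K i)%N kK)
  (insubT (fun x => x < K i)%N lK).
Qed.

Lemma BIC_pay_bound i k : (k < K i)%N ->
  nat_pay M i k <= val i k * nat_alloc M i k - rent (val i) (nat_alloc M i) k.
Proof.
apply: local_ic_pay_bound => [K0|l lK]; last exact: BIC_nat lK (ltnW lK).
(* The empty bid provides participation at the lowest value. *)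
have := @bic i (Ordinal K0) None; rewrite mul0r subrr.
by rewrite /nat_alloc /nat_pay (insubT (fun x => x < K i)%N K0).
Qed.

(** Adding the two opposite incentive constraints cancels the payments. *)
Lemma BIC_alloc_le i k : val i k < val i k.+1 -> (k.+1 < K i)%N ->
  nat_alloc M i k <= nat_alloc M i k.+1.
Proof.
move=> vk kK; have h1 := BIC_nat kK (ltnW kK); have h2 := BIC_nat (ltnW kK) kK.
rewrite -subr_ge0 -(pmulr_rge0 _ (_ : 0 < val i k.+1 - val i k)) ?subr_gt0//.
lra.
Qed.

End BIC.

End Interim.

(** Adding the two optimality inequalities leaves only coordinate [i], weighted by [c' i - c i]. *)
Lemma argmax_coord_le (R : realType) (n m : nat) (g : 'I_m -> 'rV[R]_n -> R)
    (c c' x x' : 'I_n -> R) i :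
  is_argmax R n m g c x -> is_argmax R n m g c' x' ->
  (forall j, j != i -> c j = c' j) -> c i < c' i -> x i <= x' i.
Proof.
move=> [xA xmax] [x'A x'max] cc' ci.
have rowE (d y : 'I_n -> R) : \sum_j d j * (\row_j y j) ord0 j = dot d y.
  by apply: eq_bigr => j _; rewrite mxE.
have := xmax _ x'A; have := x'max _ xA; rewrite !rowE -!/(dot _ _) => h1 h2.
have E y : dot c' y - dot c y = (c' i - c i) * y i.
  rewrite -sumrB (bigD1 i)//= big1 ?addr0; first by ring.
  by move=> j /cc' ->; rewrite subrr.
have := E x; have := E x' => E1 E2.
by rewrite -(ler_pM2l (_ : 0 < c' i - c i)) ?subr_gt0//; lra.
Qed.

(** * Optimality of the ironed virtual welfare maximizer *)

Section VirtualWelfareMaximizer.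
Variables (R : realType) (n : nat) (K : 'I_n -> nat) (val f : forall i : 'I_n, nat -> R).
Variables (m : nat) (g : 'I_m -> 'rV[R]_n -> R) (alpha : R).
Hypothesis val_lt : forall i j l, (j < l)%N -> (l < K i)%N -> val i j < val i l.
Hypothesis f_gt0 : forall i j, (j < K i)%N -> 0 < f i j.
Hypothesis f_sum1 : forall i, \sum_(j < K i) f i j = 1.
Hypothesis A_ge0 : forall x, feasA R n m g x -> forall i, 0 <= x ord0 i.
Hypothesis alpha_ge0 : 0 <= alpha.

Local Notation prof := (prof n K).
Local Notation upd := (upd n K).
Local Notation phibar := (phibar R n K val f alpha).
Local Notation bar := (phibar_prof R n K val f alpha).
Local Notation alloc := (alloc R n K).
Local Notation pay := (pay R n K).

Lemma Obj_le_ironed M : BIC R n K val f M -> Obj R n K val f alpha M <=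
  Ex R n K f (fun w => \sum_i phibar i (w i) * alloc M w i).
Proof.
move=> bic; rewrite Ex_welfare_interim Obj_interim; apply: ler_sum => i _.
apply: le_trans (_ : \sum_(k < K i) phi R n K val f alpha i k * f i k *
  nat_alloc f M i k <= _); last first.
  apply: ironed_welfare_ge => //; first exact: f_gt0.
  by move=> k kK; exact: (BIC_alloc_le bic (val_lt (ltnSn k) kK) kK).
rewrite -virtual_welfare//; last exact: f_gt0.
rewrite lerD2r ler_wpM2l//; apply: ler_sum => k _.
by rewrite ler_wpM2l ?(ltW (f_gt0 _))//; exact: BIC_pay_bound.
Qed.

Variable sel : ('I_n -> R) -> 'I_n -> R.
Hypothesis sel_argmax : forall w : prof, is_argmax R n m g (bar w) (sel (bar w)).

Local Notation Ma := (Malpha R n K val f alpha sel).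

Lemma Malpha_feasible : feasible R n K m g Ma.
Proof.
move=> w; have [selA _] := sel_argmax w; split=> // i.
by have := A_ge0 selA i; rewrite mxE.
Qed.

(** As [sel] sees only the ironed vector, reports with equal ironed values receive the same
    allocation. *)
Lemma bar_upd_eq w i (k l : 'I_(K i)) :
  phibar i k = phibar i l -> bar (upd w i k) = bar (upd w i l).
Proof.
move=> kl; apply: funext => j; rewrite /phibar_prof.
by have [->|ji] := eqVneq j i; rewrite ?upd_same// !upd_other.
Qed.

Lemma Malpha_alloc_le w i (k l : 'I_(K i)) : phibar i k <= phibar i l ->
  alloc Ma (upd w i k) i <= alloc Ma (upd w i l) i.
Proof.
rewrite le_eqVlt => /orP[/eqP kl|kl]; first by rewrite /= (bar_upd_eq _ kl).
apply: argmax_coord_le (sel_argmax _) (sel_argmax _) _ _.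
  by move=> j ji; rewrite /phibar_prof !upd_other.
by rewrite /phibar_prof !upd_same.
Qed.

(** Extended by 0 to all indices, so that the lemmas on sequences apply. *)
Definition ex_post_alloc w i (k : nat) : R :=
  if insub k is Some l then alloc Ma (upd w i l) i else 0.

Lemma ex_post_allocE w i (k : 'I_(K i)) :
  ex_post_alloc w i k = alloc Ma (upd w i k) i.
Proof. by rewrite /ex_post_alloc valK. Qed.

Lemma Malpha_pay w i (k : 'I_(K i)) : pay Ma (upd w i k) i =
  val i k * ex_post_alloc w i k - rent (val i) (ex_post_alloc w i) k.
Proof.
rewrite ex_post_allocE /= upd_same; congr (_ - _); rewrite /rent.
rewrite (big_ord_widen (K i) (fun l => (val i l.+1 - val i l) * ex_post_alloc w i l));
  last exact: ltnW.
by apply: eq_bigr => l _; rewrite upd_upd ex_post_allocE.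
Qed.

Lemma Malpha_DSIC : DSIC R n K val Ma.
Proof.
move=> i w b.
have v_le k : (k.+1 < K i)%N -> val i k <= val i k.+1.
  by move=> kK; rewrite ltW// val_lt.
have utilE k : util R n K Ma i (Some k) w (val i (w i)) =
    ex_post_alloc w i k * val i (w i) -
    (val i k * ex_post_alloc w i k - rent (val i) (ex_post_alloc w i) k).
  by rewrite /util Malpha_pay ex_post_allocE.
have a_le k : (k.+1 < K i)%N -> ex_post_alloc w i k <= ex_post_alloc w i k.+1.
  move=> kK; have kK' := ltnW kK.
  rewrite -[k]/(nat_of_ord (Ordinal kK')) -[k.+1]/(nat_of_ord (Ordinal kK)).
  rewrite !ex_post_allocE; apply: Malpha_alloc_le; apply: phibar_leS => //.
  exact: f_gt0.
rewrite utilE; case: b => [k|]; first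
  by rewrite utilE; exact: (rent_truthful v_le a_le (ltn_ord k) (ltn_ord (w i))).
(* Against the empty bid, the truthful utility is the rent, a sum of nonnegative terms. *)
rewrite /util [val i (w i) * _]mulrC opprB addrC subrK; apply: sumr_ge0 => l _.
have lK : (l.+1 < K i)%N by apply: leq_ltn_trans (ltn_ord (w i)); exact: ltn_ord.
rewrite mulr_ge0 ?subr_ge0 ?v_le//.
rewrite -[nat_of_ord l]/(nat_of_ord (Ordinal (ltnW lK))) ex_post_allocE.
exact: (Malpha_feasible _).1.
Qed.

(** The payment formula is linear in the allocation, so it survives averaging over the opponents. *)
Lemma Malpha_interim_pay i (k : 'I_(K i)) : nat_pay f Ma i k =
  val i k * nat_alloc f Ma i k - rent (val i) (nat_alloc f Ma i) k.
Proof.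
rewrite nat_payE (eq_bigr (fun w => val i k * (others_weight f i w * alloc Ma w i) -
   \sum_(l : 'I_(K i) | (l < k)%N) (val i l.+1 - val i l) *
     (others_weight f i w * alloc Ma (upd w i l) i))).
  rewrite sumrB -mulr_sumr -nat_allocE; congr (_ - _); rewrite exchange_big /rent /=.
  rewrite (big_ord_widen (K i) (fun l => (val i l.+1 - val i l) * nat_alloc f Ma i l));
    last exact: ltnW.
  apply: eq_bigr => l _; rewrite -mulr_sumr; congr (_ * _).
  rewrite nat_allocE (sum_upd k l).
  by apply: eq_bigr => w _; rewrite others_weight_upd.
move=> w /eqP wk; rewrite /= wk mulrBr mulrCA; congr (_ - _).
by rewrite mulr_sumr; apply: eq_bigr => l _; rewrite mulrCA.
Qed.

Lemma Malpha_Obj : Obj R n K val f alpha Ma =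
  Ex R n K f (fun w => \sum_i phibar i (w i) * alloc Ma w i).
Proof.
rewrite Ex_welfare_interim Obj_interim; apply: eq_bigr => i _.
rewrite -ironed_welfare_eq//; last first.
- move=> k kK kl; have kK' := ltnW kK.
  rewrite -[k]/(nat_of_ord (Ordinal kK')) -[k.+1]/(nat_of_ord (Ordinal kK)) in kl *.
  rewrite !nat_allocE (sum_upd (Ordinal kK) (Ordinal kK')).
  apply: eq_bigr => w /eqP wk; rewrite others_weight_upd /= (bar_upd_eq _ kl) -wk.
  by rewrite upd_id.
- exact: f_gt0.
rewrite -virtual_welfare//; last exact: f_gt0.
congr (_ * _ + _); apply: eq_bigr => k _; by rewrite Malpha_interim_pay.
Qed.

Lemma Malpha_BIC_opt : BIC_opt R n K val f m g alpha Ma.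
Proof.
split; first exact: Malpha_feasible.
  by apply: DSIC_BIC => //; exact: Malpha_DSIC.
move=> M feas bic; rewrite Malpha_Obj; apply: le_trans (Obj_le_ironed bic) _.
apply: ler_sum => w _; apply: ler_wpM2l; first exact: weight_ge0.
have [_ /(_ _ (feas w).2)] := sel_argmax w.
by under eq_bigr do rewrite mxE.
Qed.

End VirtualWelfareMaximizer.

Unset Implicit Arguments.

Theorem theorem4p1 (R : realType) (n : nat) (K : 'I_n -> nat)
    (val f : forall i : 'I_n, nat -> R) (m : nat) (g : 'I_m -> 'rV[R]_n -> R)
    (alpha : R) :
  (0 < n)%N ->
  (forall i j, (j < K i)%N -> 0 <= val i j) ->
  (forall i j l, (j < l)%N -> (l < K i)%N -> val i j < val i l) ->
  (forall i j, (j < K i)%N -> 0 < f i j) ->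
  (forall i, \sum_(j < K i) f i j = 1) ->
  (forall j (x y : 'rV[R]_n) (t : R), 0 <= t <= 1 ->
      g j (t *: x + (1 - t) *: y) <= t * g j x + (1 - t) * g j y) ->
  (forall j (x : 'rV[R]_n), differentiable (g j) x) ->
  (forall j (v : 'rV[R]_n), continuous (fun x => 'D_v (g j) x)) ->
  (exists x, feasA _ _ _ g x) ->
  compact [set x | feasA _ _ _ g x] ->
  (forall x, feasA _ _ _ g x -> forall i, 0 <= x ord0 i) ->
  0 <= alpha <= 1 ->
  [/\ (TDI_setting _ _ _ g ->
         exists M : auction R n K, BIC_opt _ _ K val f _ g alpha M /\ integral_auction _ _ K M),
      (forall M : auction R n K, DSIC_opt _ _ K val f _ g alpha M -> BIC_opt _ _ K val f _ g alpha M) &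
      (forall sel : ('I_n -> R) -> 'I_n -> R,
         (forall w : prof n K, is_argmax _ _ _ g (phibar_prof _ _ K val f alpha w)
                                        (sel (phibar_prof _ _ K val f alpha w))) ->
         DSIC _ _ K val (Malpha _ _ K val f alpha sel) /\
         BIC_opt _ _ K val f _ g alpha (Malpha _ _ K val f alpha sel))].
Proof.
move=> _ _ val_lt f_gt0 f_sum1 _ _ _ A0 cA A_ge0 /andP[alpha0 _].
have opt sel := @Malpha_BIC_opt R n K val f m g alpha val_lt f_gt0 f_sum1 A_ge0 alpha0 sel.
have dsic sel := @Malpha_DSIC R n K val f m g alpha val_lt f_gt0 f_sum1 A_ge0 sel.
pose A : set 'rV[R]_n := [set x | feasA R n m g x].
have face_argmax c x : face A c x -> is_argmax R n m g c (x ord0).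
  move=> [xA xmax]; split; last exact: xmax.
  by rewrite (_ : \row_i x ord0 i = x)//; apply/rowP => i; rewrite mxE.
split=> [tdi|M [Mfeas Mdsic Mopt]|sel sel_argmax]; last first.
- by split; [exact: dsic|exact: opt].
(* By compactness some [Malpha] exists; it is DSIC and optimal among BIC auctions, so a DSIC optimum
   does at least as well. *)
- have [sel selP] := choice (fun c => @face_nonempty R n A c A0 cA).
  pose sel' c := sel c ord0.
  have sel_argmax w : is_argmax R n m g (phibar_prof R n K val f alpha w)
      (sel' (phibar_prof R n K val f alpha w)) by exact: face_argmax.
  have [Mafeas _ Maopt] := opt sel' sel_argmax.
  split=> //; first exact: DSIC_BIC.
  move=> M' feas' bic'; apply: le_trans (Maopt _ feas' bic') _.
  by apply: Mopt => //; exact: dsic.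
have [p [G [b [AE tdiG]]]] := tdi.
have iA : integral_support A by exact: TDI_integral_support AE tdiG.
(* Choosing an integral maximizer for each [c] is itself a tie-breaking rule, hence gives an
   integral [Malpha]. *)
have ex_int c : exists x, face A c x /\ forall i, x ord0 i \is a Num.int.
  by have [x xf xint] := integral_argmax c A0 cA A_ge0 iA; exists x.
have [sel selP] := choice ex_int.
exists (Malpha R n K val f alpha (fun c => sel c ord0)); split.
  by apply: opt => w; apply: face_argmax; case: (selP (phibar_prof R n K val f alpha w)).
move=> w i /=; have [[xA _] xint] := selP (phibar_prof R n K val f alpha w).
by rewrite natrEint xint; exact: A_ge0.
Qed.
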